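(* Let $\Delta$ be a pure simplicial complex on vertex set $[n]=\{1,\ldots,n\}$. Then $I_{\Delta^\vee}$ has linear relations if and only if $\Delta^{(F,G)}$ is connected in codimension one for all facets $F$ and $G$ of $\Delta$.
   Context: Let $\mathcal F(\Delta)=\{F_1,\ldots,F_m\}$ be the set of facets of $\Delta$ and $\bar F_i=[n]\setminus F_i$. The Stanley-Reisner ideal of the Alexander dual $\Delta^\vee$ is $I_{\Delta^\vee}=(x_{\bar F_i}: i=1,\ldots,m)\subset S=k[x_1,\ldots,x_n]$, where $x_F=\prod_{i\in F}x_i$ and $k$ is a field. For an ideal $I$ generated in one degree with minimal monomial generators $u_1,\ldots,u_m$, let $\varphi:\bigoplus_i Se_i\to I$, $e_i\mapsto u_i$; $I$ has linear relations if $\ker(\varphi)$ is minimally generated by linear forms (elements whose coefficients with respect to the $e_i$ are of degree 1). For facets $F,G$ of $\Delta$, $\Delta^{(F,G)}=\langle L\in\mathcal F(\Delta): F\cap G\subseteq L\rangle$ is the subcomplex generated by those facets. A pure simplicial complex is connected in codimension one if for any two of its facets $F,G$ there is a sequence of its facets $F=H_0,H_1,\ldots,H_q=G$ with $|H_i\cap H_{i+1}|=|H_i|-1$ for all $i=0,\ldots,q-1$. *)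

(* Defs.v *)
From HB Require Import structures.
From mathcomp Require Import all_boot all_order all_algebra.
From mathcomp Require Import mpoly.

Set Implicit Arguments.
Unset Strict Implicit.
Unset Printing Implicit Defensive.

Import GRing.Theory.
Local Open Scope ring_scope.

Section Complexes.
Variable T : finType.
Implicit Types (D : {set {set T}}) (F G H : {set T}).

(* Points of T are not required to be faces, so that the Alexander dual is
   always a simplicial complex; the void complex set0 is allowed as well. *)
Definition simplicial_complex D : Prop :=
  forall F G, F \in D -> G \subset F -> G \in D.

Definition facets D : {set {set T}} := [set F | maxset (mem D) F].

Definition pure D : Prop :=
  forall F G, F \in facets D -> G \in facets D -> #|F| = #|G|.

Definition generated_complex (L : {set {set T}}) : {set {set T}} :=
  [set H : {set T} | [exists F in L, H \subset F]].

(* The complex written Delta^(F,G) in the literature. *)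
Definition facet_pair_complex D F G : {set {set T}} :=
  generated_complex [set L in facets D | F :&: G \subset L].

(* |H :&: H'| = |H| - 1, without truncated subtraction. *)
Definition adjacent_codim1 : rel {set T} :=
  fun H H' => #|H :&: H'|.+1 == #|H|.

Definition connected_codim1 D : Prop :=
  pure D /\
  forall F G, F \in facets D -> G \in facets D ->
    exists Hs : seq {set T},
      [/\ {subset Hs <= facets D}, path adjacent_codim1 F Hs & last F Hs = G].

Definition alexander_dual D : {set {set T}} := [set ~: F | F in ~: D].

End Complexes.

Section Generators.
Variables (R : nzRingType) (V : lmodType R) (I : finType).

Definition spanned (A : {set I}) (g : I -> V) (v : V) : Prop :=
  exists a : I -> R, v = \sum_(i in A) a i *: g i.

Definition minimal_generators (N : V -> Prop) (g : I -> V) : Prop :=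
  (forall v, N v <-> spanned [set: I] g v) /\
  (forall A : {set I}, (forall v, N v <-> spanned A g v) -> A = [set: I]).

End Generators.

(* Ideals of S = k[x_1, ..., x_n] are handled as submodules of the regular
   module S^o, whose scaling a *: u is the product a * u. *)
Section Ideals.
Variables (k : fieldType) (n : nat).
Local Notation S := {mpoly k[n]}.

Definition squarefree_monomial (F : {set 'I_n}) : S := \prod_(i in F) 'X_i.

Definition stanley_reisner_ideal (D : {set {set 'I_n}}) : S -> Prop :=
  spanned (V := S^o) (~: D) squarefree_monomial.

Definition relation_of (m : nat) (u : 'I_m -> S) (c : 'rV[S]_m) : Prop :=
  \sum_(i < m) c 0 i * u i = 0.

Definition linear_form (m : nat) (c : 'rV[S]_m) : Prop :=
  forall i, c 0 i \is 1.-homog.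

(* The minimal monomial generators of I are unique up to their numbering. *)
Definition has_linear_relations (I : S -> Prop) : Prop :=
  exists (m : nat) (u : 'I_m -> 'X_{1..n}),
    [/\ minimal_generators (V := S^o) I (fun i => 'X_[k, u i]),
        exists d, forall i, mdeg (u i) = d
      & exists (r : nat) (g : 'I_r -> 'rV[S]_m),
          minimal_generators (relation_of (fun i => 'X_[k, u i])) g /\
          forall j, linear_form (g j)].

End Ideals.

Lemma alexander_dual_complex (T : finType) (D : {set {set T}}) :
  simplicial_complex D -> simplicial_complex (alexander_dual D).
Proof.
move=> cD _ G /imsetP[F FD ->] GF; apply/imsetP; exists (~: G); rewrite ?setCK //.
rewrite inE in FD; rewrite inE; apply: contra FD => /cD; apply.
by rewrite -setCS setCK.
Qed.

Lemma generated_complex_complex (T : finType) (L : {set {set T}}) :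
  simplicial_complex (generated_complex L).
Proof.
move=> F G; rewrite !inE => /existsP[H /andP[HL FH]] GF.
by apply/existsP; exists H; rewrite HL (subset_trans GF).
Qed.

Lemma stanley_reisner_alexander_dual (k : fieldType) (n : nat)
    (D : {set {set 'I_n}}) :
  simplicial_complex D ->
  forall p : {mpoly k[n]},
    stanley_reisner_ideal (alexander_dual D) p <->
    spanned (V := {mpoly k[n]}^o) (facets D)
      (fun F => squarefree_monomial k (~: F)) p.
Proof.
move=> cD p.
have inC F : (F \in ~: alexander_dual D) = (~: F \in D).
  rewrite inE -[RHS]negbK; congr (~~ _); apply/imsetP/idP.
    by case=> G; rewrite inE => GD ->; rewrite setCK.
  by move=> FD; exists (~: F); rewrite ?inE ?setCK.
split=> -[a ->].
  have /fin_all_exists[h hP] : forall F : {set 'I_n}, exists G : {set 'I_n},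
      F \in D -> (G \in facets D) && (F \subset G).
    move=> F; case: (boolP (F \in D)) => [FD|_]; last by exists F.
    have [G mG sFG] := @maxset_exists _ (mem D) _ FD.
    by exists G; rewrite inE mG.
  exists (fun G => \sum_(F | (~: F \in D) && (h (~: F) == G))
     a F * squarefree_monomial k (F :&: G)).
  rewrite (partition_big (fun F => h (~: F)) (mem (facets D))) /=; last first.
    by move=> F; rewrite inC => /hP/andP[].
  apply: eq_bigr => G _; rewrite /GRing.scale /= mulr_suml.
  apply: eq_big => [F|F /andP[]]; first by rewrite inC.
  rewrite inC => /hP/andP[_] sFh /eqP hG; rewrite {}hG in sFh.
  rewrite -mulrA; congr (_ * _); rewrite /squarefree_monomial.
  rewrite (big_setID G) /=; congr (_ * _); apply: eq_bigl => i.
  rewrite !inE; case: (boolP (i \in G)) => //= iG.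
  by apply/negPn/negP => iF; move/negP: iG; apply; apply: (subsetP sFh); rewrite inE.
exists (fun F => if ~: F \in facets D then a (~: F) else 0).
rewrite (reindex_inj (inv_inj (@setCK 'I_n))) /=.
rewrite [RHS](bigID (fun F : {set 'I_n} => ~: F \in facets D)) /=.
rewrite [X in _ = _ + X]big1 ?addr0; last first.
  by move=> F /andP[_ /negPf ->]; rewrite scale0r.
apply: eq_big => [F|F]; last by move=> ->; rewrite setCK.
rewrite inC andbC; case: (boolP (~: F \in facets D)) => //=.
by rewrite inE => /maxsetp /= ->.
Qed.

(* Main.v *)
Require Import Defs.
From mathcomp Require Import all_boot all_order all_algebra.
From mathcomp Require Import mpoly.
From Stdlib Require Import Classical_Prop.

Set Implicit Arguments.
Unset Strict Implicit.
Unset Printing Implicit Defensive.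

Import GRing.Theory.

(** Write u_F for the product of the variables outside a facet F. These
monomials all have the same degree d, and they are the minimal generators of
the ideal. The monomials u_F and u_G have least common multiple x^w, where w is
the complement of F :&: G, and u_H divides x^w exactly when F :&: G is
contained in H. So connectivity of the complex attached to (F, G) concerns the
generators that divide lcm(u_F, u_G). Two facets are adjacent in codimension
one exactly when lcm(u_F, u_G) has degree d + 1, that is, when the relation
(x^w / u_F) e_F - (x^w / u_G) e_G is linear.

Suppose the relations are generated by linear ones. Let C be the set of facets
reachable from F through facets containing F :&: G, and map a relation c to
psi(c), the sum of c_H u_H over H in C. This map is linear over the polynomial
ring. The generators occurring in one multidegree of total degree d + 1 that
divides x^w are pairwise adjacent or equal, so C contains all of them or none; hence psi
kills every linear relation in all degrees dividing x^w, and this vanishing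
passes to multiples. On the relation between e_F and e_G, psi would be x^w if G
were not in C. Therefore G lies in C ([linear_relations_connect]).

Conversely, split a relation by multidegree. In degree v it is a combination,
with coefficients summing to 0, of the elements (x^v / u_F) e_F with u_F
dividing x^v, so it suffices to generate the differences of two of these
([spanned_fiberwise]). A path of adjacent facets from F to G through facets
containing F :&: G writes such a difference as a telescoping sum of multiples
of linear relations ([path_relation]). An irredundant subfamily of these
finitely many linear relations is then a minimal generating set
([minimal_generators_subfamily]).

It suffices to treat pairs: if F and G both contain F0 :&: G0, then a path
through facets containing F :&: G stays among those containing F0 :&: G0. *)

(** * Spans and irredundant generating families *)

Section Spans.
Local Open Scope ring_scope.
Variables (R : nzRingType) (V : lmodType R).
Implicit Types (I J X : finType).

Lemma spanned_gen I (A : {set I}) (g : I -> V) i : i \in A -> spanned A g (g i).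
Proof.
move=> iA; exists (fun j => (j == i)%:R).
rewrite (bigD1 i) //= eqxx scale1r big1 ?addr0 // => j /andP[_ /negPf ->].
by rewrite scale0r.
Qed.

Lemma spanned0 I (A : {set I}) (g : I -> V) : spanned A g 0.
Proof. by exists (fun=> 0); rewrite big1 // => i _; rewrite scale0r. Qed.

Lemma spannedD I (A : {set I}) (g : I -> V) v w :
  spanned A g v -> spanned A g w -> spanned A g (v + w).
Proof.
move=> [a ->] [b ->]; exists (fun i => a i + b i).
by rewrite -big_split; apply: eq_bigr => i _; rewrite scalerDl.
Qed.

Lemma spannedZ I (A : {set I}) (g : I -> V) c v :
  spanned A g v -> spanned A g (c *: v).
Proof.
move=> [a ->]; exists (fun i => c * a i).
by rewrite scaler_sumr; apply: eq_bigr => i _; rewrite scalerA.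
Qed.

Lemma spanned_sum I (A : {set I}) (g : I -> V) X (P : pred X) (f : X -> V) :
  (forall x, P x -> spanned A g (f x)) -> spanned A g (\sum_(x | P x) f x).
Proof.
move=> gf; apply: (big_ind (spanned A g)) gf; first exact: spanned0.
exact: spannedD.
Qed.

Lemma spanned_trans I J (A : {set I}) (B : {set J}) (g : I -> V) (h : J -> V) v :
  (forall i, i \in A -> spanned B h (g i)) -> spanned A g v -> spanned B h v.
Proof.
by move=> gh [a ->]; apply: spanned_sum => i /gh gi; apply: spannedZ.
Qed.

Lemma spanned_imset I J (A : {set J}) (f : J -> I) (g : I -> V) v :
  spanned A (fun j => g (f j)) v <-> spanned (f @: A) g v.
Proof.
split; apply: spanned_trans.
  by move=> j jA; apply: spanned_gen; apply: imset_f.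
by move=> _ /imsetP[j jA ->]; apply: (spanned_gen (fun j => g (f j))).
Qed.

(** The fibres of [w] play the part of multidegrees: in one fibre all the [h x]
agree modulo the span, so a combination of them whose coefficients sum to 0
vanishes modulo the span. *)
Lemma spanned_fiberwise I (A : {set I}) (g : I -> V)
    X (L : choiceType) (w : X -> L) (t : X -> R) (h : X -> V) :
  (forall x y, w x = w y -> spanned A g (h x - h y)) ->
  (forall l, \sum_(x | w x == l) t x = 0) ->
  spanned A g (\sum_x t x *: h x).
Proof.
move=> hw t0.
(* Only finitely many labels occur, so the sum can be grouped by them. *)
rewrite (partition_big (fun x => SeqSub (codom_f w x)) predT) //=.
apply: spanned_sum => l' _; under eq_bigl do rewrite -val_eqE /=.
move: (ssval l') => {l'} l.
have [x /eqP wx|w0] := pickP (fun x => w x == l); last first.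
  by rewrite big_pred0 //; exact: spanned0.
have -> : \sum_(y | w y == l) t y *: h y
        = \sum_(y | w y == l) t y *: (h y - h x).
  under [RHS]eq_bigr do rewrite scalerBr.
  by rewrite sumrB -scaler_suml t0 scale0r subr0.
apply: spanned_sum => y /eqP wy; apply: spannedZ.
by apply: hw; rewrite wx wy.
Qed.

(** Among the subsets of a finite generating family that still generate, one
that is minimal for inclusion exists by descent on the cardinality; excluded
middle decides whether a smaller generating subset remains. *)
Lemma minimal_generators_subfamily J (N : V -> Prop) (g : J -> V) :
  (forall v, N v <-> spanned [set: J] g v) ->
  exists (r : nat) (f : 'I_r -> J), minimal_generators N (fun i => g (f i)).
Proof.
move=> Ng.
suff [B [NB minB]] : exists B : {set J}, (forall v, N v <-> spanned B g v) /\
    forall C : {set J}, C \subset B -> (forall v, N v <-> spanned C g v) -> C = B.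
  pose f := @enum_val J (mem B); exists #|B|, f; split.
    move=> v; rewrite spanned_imset NB; suff -> : f @: setT = B by [].
    apply/setP=> j; apply/imsetP/idP=> [[i _ ->]|jB]; first exact: enum_valP.
    by exists (enum_rank_in jB j); rewrite /f ?enum_rankK_in.
  move=> A NA; have {}NA : f @: A = B.
    apply: minB => [|v]; last by rewrite NA spanned_imset.
    by apply/subsetP=> _ /imsetP[i _ ->]; apply: enum_valP.
  apply/setP=> i; rewrite inE; have : f i \in f @: A by rewrite NA; exact: enum_valP.
  by case/imsetP=> j jA /enum_val_inj ->.
have [s] := ubnP #|[set: J]|; elim: s [set: J] Ng => // s IHs A NA sA.
have [[C [CA NC]]|minA] := classic (exists C : {set J}, C \proper A /\
    forall v, N v <-> spanned C g v).
  by apply: (IHs C NC); apply: leq_trans (proper_card CA) _.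
exists A; split=> // C CA NC; apply/eqP; rewrite eqEproper CA /=.
by apply/negP=> CpA; case: minA; exists C.
Qed.

End Spans.

(** * Monomials *)

Section Monomials.
Local Open Scope ring_scope.
Variables (k : fieldType) (n : nat).
Implicit Types (A B : {set 'I_n}) (v w : 'X_{1..n}) (p : {mpoly k[n]}).

Lemma squarefree_monomialE A : squarefree_monomial k A = 'X_[mesym1 A].
Proof.
rewrite mpolyXE_id /squarefree_monomial big_mkcond /=.
by apply: eq_bigr => i _; rewrite mnmE; case: (i \in A).
Qed.

Lemma mesym1_le A B : (mesym1 A <= mesym1 B)%MM = (A \subset B).
Proof.
apply/mnm_lepP/subsetP=> [AB i iA|AB i].
  by have := AB i; rewrite !mnmE iA; case: (i \in B).
by rewrite !mnmE; have := AB i; case: (i \in A) => // ->.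
Qed.

Lemma mesym1U_le A B v :
  (mesym1 A <= v)%MM -> (mesym1 B <= v)%MM -> (mesym1 (A :|: B) <= v)%MM.
Proof.
move=> /mnm_lepP Av /mnm_lepP Bv; apply/mnm_lepP=> i.
by have := Av i; have := Bv i; rewrite !mnmE inE; case: (i \in A).
Qed.

Lemma lepm_mdeg v w : (mdeg w <= mdeg v)%N -> (v <= w)%MM -> v = w.
Proof.
move=> dw /submK wE; move: dw; rewrite -{1}wE mdegD -{2}[mdeg v]add0n leq_add2r.
by rewrite leqn0 mdeg_eq0 => /eqP wv0; rewrite -wE wv0 add0m.
Qed.

Lemma mcoeffMX_neq0 p v w :
  (p * 'X_[v])@_w != 0 -> (v <= w)%MM && (p@_(w - v) != 0).
Proof.
rewrite -mcoeff_msupp (perm_mem (msuppMX _ _)) => /mapP[a pa ->].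
by rewrite lem_addr addmC addmK -mcoeff_msupp.
Qed.

Lemma monomial_spanned (I : finType) (A : {set I}) (u : I -> 'X_{1..n}) w :
  spanned (V := {mpoly k[n]}^o) A (fun i => 'X_[k, u i]) 'X_[k, w] ->
  exists2 i, i \in A & (u i <= w)%MM.
Proof.
case=> a /(congr1 (mcoeff w)); rewrite mcoeffX eqxx raddf_sum /= => sum1.
have [i /andP[iA ui]|noA] := pickP (fun i => (i \in A) && (u i <= w)%MM).
  by exists i.
move/eqP: sum1; rewrite big1 ?oner_eq0 // => i iA; apply/eqP.
apply: contraFT (noA i) => /mcoeffMX_neq0/andP[ui _].
by rewrite iA.
Qed.

Lemma sum_scale_delta m (P : pred 'I_m) (p : {mpoly k[n]}) i (f : 'I_m -> {mpoly k[n]}) :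
  \sum_(j | P j) (p *: delta_mx 0 i : 'rV_m) 0 j * f j = (p * f i) *+ P i.
Proof.
have [Pi|nPi] := boolP (P i).
  rewrite (bigD1 i) //= big1 => [|j /andP[_ /negPf ji]].
    by rewrite !mxE !eqxx mulr1 addr0.
  by rewrite !mxE eqxx ji mulr0 mul0r.
rewrite big1 // => j Pj; rewrite !mxE eqxx; case: eqP => [ji|_].
  by rewrite -ji Pj in nPi.
by rewrite mulr0 mul0r.
Qed.

Lemma sum_scale_deltaB m (P : pred 'I_m) (p q : {mpoly k[n]}) i j
    (f : 'I_m -> {mpoly k[n]}) :
  \sum_(l | P l) (p *: delta_mx 0 i - q *: delta_mx 0 j : 'rV_m) 0 l * f l
    = (p * f i) *+ P i - (q * f j) *+ P j.
Proof.
rewrite -!sum_scale_delta -sumrB; apply: eq_bigr => l _.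
by rewrite -mulrBl; congr (_ * _); rewrite !mxE.
Qed.

End Monomials.

(** * Facets *)

Section Facets.
Variable T : finType.
Implicit Types (D : {set {set T}}) (F G H : {set T}).

(** This lets the facets of a complex serve as the facets of any complex that
some of them generate. *)
Lemma facets_antichain D F G :
  F \in facets D -> G \in facets D -> F \subset G -> F = G.
Proof.
rewrite !inE => /maxsetP[_ maxF] /maxsetP[GD _] FG.
by rewrite (maxF G).
Qed.

Lemma facets_pair_complex D F G :
  facets (facet_pair_complex D F G) = [set L in facets D | F :&: G \subset L].
Proof.
set L := [set _ in _ | _].
have sLD H : H \in L -> H \in facets D by rewrite [in X in X -> _]inE => /andP[].
have gP (K : {set T}) : reflect (exists2 M, M \in L & K \subset M)
                    (mem (facet_pair_complex D F G) K).
  by rewrite -[mem _ _]/(K \in generated_complex L) inE; apply: exists_inP.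
apply/setP=> H; rewrite inE; apply/maxsetP/idP=> [[/gP[K KL HK] maxH]|HL].
  by rewrite -(maxH K) //; apply/gP; exists K.
split=> [|K /gP[M ML KM] HK]; first by apply/gP; exists H.
apply/eqP; rewrite eqEsubset HK andbT.
by rewrite (facets_antichain (sLD _ HL) (sLD _ ML)) // (subset_trans HK).
Qed.

End Facets.

(** * From linear relations to connectivity *)

Section Connectivity.
Local Open Scope ring_scope.
Variables (k : fieldType) (n : nat).

(** A monomial in a monomial ideal is divisible by one of its generators. Going
from the family [u] to the facet monomials and back gives divisibilities that
are equalities, because the [u i] have equal degrees and the facets form an
antichain. *)
Lemma generators_facets (D : {set {set 'I_n}}) m (u : 'I_m -> 'X_{1..n}) d :
  simplicial_complex D ->
  (forall p, stanley_reisner_ideal (alexander_dual D) p <->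
     spanned (V := {mpoly k[n]}^o) [set: 'I_m] (fun i => 'X_[k, u i]) p) ->
  (forall i, mdeg (u i) = d) ->
  (forall i, exists2 F, F \in facets D & u i = mesym1 (~: F)) /\
  (forall F, F \in facets D -> exists i, u i = mesym1 (~: F)).
Proof.
move=> cD Iu du.
have IF p : stanley_reisner_ideal (alexander_dual D) p <->
    spanned (V := {mpoly k[n]}^o) (facets D) (fun F => 'X_[k, mesym1 (~: F)]) p.
  rewrite stanley_reisner_alexander_dual //; split=> -[a ->]; exists a;
  by apply: eq_bigr => F _; rewrite squarefree_monomialE.
have uF i : exists2 F, F \in facets D & (mesym1 (~: F) <= u i)%MM.
  apply: (@monomial_spanned k); apply/IF/Iu.
  by apply: (spanned_gen (V := {mpoly k[n]}^o)); rewrite inE.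
have Fu F : F \in facets D -> exists i, (u i <= mesym1 (~: F))%MM.
  move=> FD; have [|i _ ui] := @monomial_spanned k n _ setT u (mesym1 (~: F)).
    apply/Iu/IF.
    exact: (spanned_gen (V := {mpoly k[n]}^o) (fun F => 'X_[k, mesym1 (~: F)])).
  by exists i.
split=> [i|F FD].
  have [F FD Fi] := uF i; have [j jF] := Fu F FD; exists F => //.
  apply/esym/lepm_mdeg => //; rewrite du -(du j).
  by have /mnm_lepP jF' := jF; rewrite !mdegE leq_sum.
have [i iF] := Fu F FD; have [G GD Gi] := uF i; exists i.
have GF : F = G.
  apply: (facets_antichain FD GD); rewrite -setCS -mesym1_le.
  exact: lepm_trans Gi iF.
rewrite -GF in Gi; apply/mnmP=> l; apply/eqP.
by rewrite eqn_leq (mnm_lepP iF) (mnm_lepP Gi).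
Qed.

(** The obstruction: were [H j0] not reachable from [H i0], the partial sum of a
relation over the reachable indices would have a zero coefficient at the least
common multiple of the two generators for every combination of linear
relations, but not for the relation between these two generators. The graph [e]
is only asked to contain the adjacencies between facets above the
intersection. *)
Lemma linear_relations_connect m r (u : 'I_m -> 'X_{1..n})
    (H : 'I_m -> {set 'I_n}) (g : 'I_r -> 'rV[{mpoly k[n]}]_m) i0 j0
    (e : rel {set 'I_n}) :
  (forall i, u i = mesym1 (~: H i)) -> (forall i j, #|H i| = #|H j|) ->
  (forall c, relation_of (fun i => 'X_[k, u i]) c <->
     spanned [set: 'I_r] g c) ->
  (forall j, linear_form (g j)) ->
  (forall i j, H i0 :&: H j0 \subset H i -> H i0 :&: H j0 \subset H j ->
     adjacent_codim1 (H i) (H j) -> e (H i) (H j)) ->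
  connect e (H i0) (H j0).
Proof.
set w := mesym1 (~: (H i0 :&: H j0)) => uH cardH relg ling eH.
pose C i := connect e (H i0) (H i).
pose psi (c : 'rV[{mpoly k[n]}]_m) := \sum_(i | C i) c 0 i * 'X_[u i].
have psig j v : (v <= w)%MM -> (psi (g j))@_v = 0.
  move=> vw.
  have gj : \sum_i (g j 0 i * 'X_[k, u i])@_v = 0.
    rewrite -raddf_sum /=; have -> : \sum_i g j 0 i * 'X_[k, u i] = 0.
      by apply/relg/spanned_gen; rewrite inE.
    by rewrite mcoeff0.
  rewrite raddf_sum /=; have termP i : (g j 0 i * 'X_[k, u i])@_v != 0 ->
      [/\ (u i <= v)%MM, H i0 :&: H j0 \subset H i & (mdeg v = (mdeg (u i)).+1)].
    move=> /mcoeffMX_neq0/andP[uv gv]; split=> //.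
      by rewrite -setCS -mesym1_le -uH (lepm_trans uv).
    rewrite -{1}(submK uv) mdegD.
    by have /dhomogP -> := ling j i; rewrite ?mcoeff_msupp.
  have [i /andP[Ci nzi]|C0] :=
    pickP (fun i => C i && ((g j 0 i * 'X_[k, u i])@_v != 0)); last first.
    by rewrite big1 // => i Ci; apply/eqP; have := C0 i; rewrite Ci => /negbFE.
  (* Once one term of degree v lies in C all of them do, so the partial sum is
     the full sum, which vanishes. *)
  rewrite -[RHS]gj [RHS](bigID C) /= [X in _ + X]big1 ?addr0 // => l nCl.
  apply/eqP; apply: contraNT nCl => nzl; rewrite /C.
  have [uiv Hi di] := termP i nzi; have [ulv Hl _] := termP l nzl.
  (* Both generators divide v, whose degree is one more than theirs, so their
     least common multiple has degree at most d + 1. *)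
  have cardI : (#|H i| <= #|H i :&: H l|.+1)%N.
    rewrite !uH in uiv ulv di; have /mnm_lepP le_v := mesym1U_le uiv ulv.
    have : (#|~: (H i :&: H l)| <= #|~: H i|.+1)%N.
      by rewrite setCI -!mdeg_mesym1 -di !mdegE leq_sum.
    rewrite -(leq_add2l #|H i :&: H l|) cardsC addnS -(cardsC (H i)) -addSn.
    by rewrite leq_add2r.
  have [Hil|nHil] := boolP (H i \subset H l).
    suff <- : H i = H l by [].
    by apply/eqP; rewrite eqEcard Hil (cardH l i) leqnn.
  apply: connect_trans Ci (connect1 _); apply: eH => //.
  rewrite /adjacent_codim1 eqn_leq cardI andbT.
  apply: proper_card; rewrite properEneq subsetIl andbT.
  by apply: contra nHil => /eqP/setIidPl.
(* Polynomials with no monomial dividing w form an ideal. *)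
have psi_span c v : spanned [set: 'I_r] g c -> (v <= w)%MM -> (psi c)@_v = 0.
  case=> a -> vw.
  have -> : psi (\sum_(j in setT) a j *: g j) = \sum_j a j * psi (g j).
    rewrite /psi; under [RHS]eq_bigr do rewrite mulr_sumr.
    rewrite exchange_big; apply: eq_bigr => i _.
    rewrite summxE mulr_suml; apply: eq_big => [j|j _]; first by rewrite inE.
    by rewrite mxE mulrA.
  rewrite raddf_sum big1 //= => j _; rewrite mcoeffM big1 // => -[a1 a2] /= /eqP vE.
  by rewrite psig ?mulr0 //; apply: lepm_trans vw; have := lem_addl a1 a2; rewrite -vE.
have uw i : H i0 :&: H j0 \subset H i -> (u i <= w)%MM.
  by rewrite uH mesym1_le setCS.
pose c : 'rV[{mpoly k[n]}]_m :=
  'X_[w - u i0] *: delta_mx 0 i0 - 'X_[w - u j0] *: delta_mx 0 j0.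
have csum (P : pred 'I_m) :
    \sum_(i | P i) c 0 i * 'X_[u i] = 'X_[w] *+ P i0 - 'X_[w] *+ P j0.
  apply: etrans (sum_scale_deltaB _ _ _ _ _ _) _.
  by rewrite -!mpolyXD !submK ?uw ?subsetIl ?subsetIr.
have relc : relation_of (fun i => 'X_[k, u i]) c.
  by rewrite /relation_of (csum predT) subrr.
have := psi_span _ w (proj1 (relg c) relc) (lepm_refl _).
rewrite /psi csum {1}/C connect0 -/(C j0); case: (C j0) => //.
by rewrite subr0 mcoeffX eqxx => /eqP; rewrite oner_eq0.
Qed.

End Connectivity.

(** * From connectivity to linear relations *)

Section LinearRelations.
Local Open Scope ring_scope.
Variables (k : fieldType) (n m : nat) (H : 'I_m -> {set 'I_n}).
Let u i : 'X_{1..n} := mesym1 (~: H i).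

Definition adjacent_relation (ij : 'I_m * 'I_m) : 'rV[{mpoly k[n]}]_m :=
  if adjacent_codim1 (H ij.1) (H ij.2) then
    'X_[mesym1 (H ij.1 :\: H ij.2)] *: delta_mx 0 ij.1
      - 'X_[mesym1 (H ij.2 :\: H ij.1)] *: delta_mx 0 ij.2
  else 0.

(** Adjacent facets of the same size differ by exchanging one vertex, so both
coefficients are variables. *)
Lemma adjacent_relation_linear :
  (forall i j, #|H i| = #|H j|) -> forall ij, linear_form (adjacent_relation ij).
Proof.
move=> cardH [i j] l; rewrite /adjacent_relation /=.
case: ifP => [/eqP adj|_]; last by rewrite mxE rpred0.
have cardD i' j' : #|H i' :&: H j'| = #|H i :&: H j| -> #|H i' :\: H j'| = 1%N.
  move=> cI; have := cardsID (H j') (H i').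
  by rewrite cI (cardH i' i) -adj -addn1 => /addnI.
have homD i' j' : #|H i' :&: H j'| = #|H i :&: H j| -> forall b : bool,
    'X_[k, mesym1 (H i' :\: H j')] * b%:R \is 1.-homog.
  move=> /cardD cD [] /=; last by rewrite mulr0 rpred0.
  by rewrite mulr1 dhomogX /= mdeg_mesym1 cD.
rewrite !mxE rpredB //; first exact: homD.
by apply: homD; rewrite setIC.
Qed.

(** This is lcm(u_A, u_B) = x_(A \ B) u_A. *)
Lemma mesym1_split (A B : {set 'I_n}) :
  (mesym1 (~: (A :&: B)) = mesym1 (A :\: B) + mesym1 (~: A))%MM.
Proof.
by apply/mnmP=> l; rewrite !mnmE !inE; case: (l \in A); case: (l \in B).
Qed.

Lemma adjacent_relationP ij :
  relation_of (fun i => 'X_[k, u i]) (adjacent_relation ij).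
Proof.
case: ij => i j; rewrite /relation_of /adjacent_relation /=.
case: ifP => _; last by rewrite big1 // => l _; rewrite mxE mul0r.
apply: etrans (sum_scale_deltaB predT _ _ _ _ _) _.
by rewrite -!mpolyXD -(mesym1_split (H i)) -(mesym1_split (H j)) setIC subrr.
Qed.

(** Telescoping along the path: each step is the multiple of an adjacent relation
by the quotient of x^v by the least common multiple of its two generators. *)
Lemma path_relation i s v :
  path (relpre H (@adjacent_codim1 _)) i s -> all (fun l => (u l <= v)%MM) (i :: s) ->
  spanned [set: 'I_m * 'I_m] adjacent_relation
    ('X_[v - u i] *: delta_mx 0 i - 'X_[v - u (last i s)] *: delta_mx 0 (last i s)).
Proof.
elim: s i => [|j s IHs] i /=; first by rewrite subrr => *; exact: spanned0.
case/andP=> adj pj /and3P[ui uj us]; rewrite /= in adj.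
have jv : spanned [set: 'I_m * 'I_m] adjacent_relation
    ('X_[v - u i] *: delta_mx 0 i - 'X_[v - u j] *: delta_mx 0 j).
  have Uv : (mesym1 (~: (H i :&: H j)) <= v)%MM by rewrite setCI mesym1U_le.
  have shift l A : mesym1 (~: (H i :&: H j)) = (mesym1 A + u l)%MM ->
      (v - u l = v - mesym1 (~: (H i :&: H j)) + mesym1 A)%MM.
    by move=> E; rewrite -{1}(submK Uv) {2}E addmA addmK.
  rewrite (shift _ _ (mesym1_split _ _)) (shift j (H j :\: H i)); last first.
    by rewrite setIC -mesym1_split.
  rewrite !mpolyXD -!scalerA -scalerBr; apply: spannedZ.
  have := spanned_gen adjacent_relation (in_setT (i, j)).
  by rewrite /adjacent_relation /= adj.
have ujs : all (fun l => (u l <= v)%MM) (j :: s) by rewrite /= uj.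
by have := spannedD jv (IHs j pj ujs); rewrite addrA subrK.
Qed.

(** The terms of a relation are indexed by pairs of a generator and a monomial of
its coefficient; grouped by multidegree, their coefficients sum to 0. *)
Lemma relations_spanned_by_adjacent :
  (forall i j, exists s, [/\ path (relpre H (@adjacent_codim1 _)) i s,
     all (fun l => H i :&: H j \subset H l) s & last i s = j]) ->
  forall c, relation_of (fun i => 'X_[k, u i]) c <->
            spanned [set: 'I_m * 'I_m] adjacent_relation c.
Proof.
move=> connH c; split=> [relc|[a ->]]; last first.
  rewrite /relation_of; under eq_bigr => i _ do rewrite summxE mulr_suml.
  rewrite exchange_big big1 //= => ij _.
  under eq_bigr => i _ do rewrite mxE -mulrA.
  by rewrite -mulr_sumr adjacent_relationP mulr0.
pose b := \max_i msize (c 0%R i).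
pose t (x : 'I_m * 'X_{1..n < b}) : {mpoly k[n]} := ((c 0 x.1)@_(x.2))%:MP.
have cE i : c 0 i = \sum_(a : 'X_{1..n < b}) t (i, a) * 'X_[a].
  have ib : (msize (c 0%R i) <= b)%N.
    exact: (leq_bigmax (F := fun i => msize (c 0 i))).
  apply: etrans (mpolywE ib) _.
  by apply: eq_bigr => a _; rewrite mul_mpolyC.
have -> : c = \sum_x t x *: ('X_[x.2] *: delta_mx 0 x.1).
  apply: etrans (row_sum_delta c) _.
  under eq_bigr => i _ do rewrite cE scaler_suml.
  by rewrite pair_bigA /=; apply: eq_bigr => -[i a] _; rewrite scalerA.
pose w (x : 'I_m * 'X_{1..n < b}) : 'X_{1..n} := (x.2 + u x.1)%MM.
apply: (spanned_fiberwise (w := w)) => [x y wxy|v].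
  have [s [pi s_sub lasti]] := connH x.1 y.1.
  have := @path_relation x.1 s (w x) pi; rewrite lasti {3}wxy /w !addmK.
  apply; rewrite /= lem_addl /=; apply/allP=> l /(allP s_sub) xyl.
  apply: (lepm_trans (m2 := mesym1 (~: (H x.1 :&: H y.1)))).
    by rewrite mesym1_le setCS.
  by rewrite setCI mesym1U_le ?lem_addl // -/(w x) wxy lem_addl.
(* The coefficient of x^v in the relation is the sum over the fibre of v. *)
have : (\sum_i c 0 i * 'X_[k, u i])@_v = 0 by rewrite relc mcoeff0.
under eq_bigr => i _ do rewrite cE mulr_suml.
rewrite pair_bigA /= raddf_sum /= => sum0.
rewrite -rmorph_sum /=; set z := (X in X%:MP); suff -> : z = 0 by rewrite mpolyC0.
rewrite -sum0 /z big_mkcond; apply: eq_bigr => -[i a] _ /=.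
by rewrite -mulrA -mpolyXD mcoeffCM mcoeffX /w; case: eqP; rewrite ?mulr1 ?mulr0.
Qed.

End LinearRelations.

Theorem corollary4p2 (k : fieldType) (n : nat) (Delta : {set {set 'I_n}})
    (complex_Delta : simplicial_complex Delta) (pure_Delta : pure Delta) :
  has_linear_relations (@stanley_reisner_ideal k n (alexander_dual Delta)) <->
  (forall F G : {set 'I_n}, F \in facets Delta -> G \in facets Delta ->
     connected_codim1 (facet_pair_complex Delta F G)).
Proof.
split=> [[m [u [[Iu _] [d du] [r [g [[relg _] ling]]]]]] F0 G0 _ _|conn].
  have [uF Fu] := generators_facets complex_Delta Iu du.
  have [H HD uH] := fin_all_exists2 uF.
  have HP F : F \in facets Delta -> exists i, H i = F.
    by move=> /Fu[i]; rewrite uH => /(@inj_mesym1 n)/setC_inj; exists i.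
  split=> [F G|F G]; rewrite facets_pair_complex ![_ \in [set _ in _ | _]]inE.
    by case/andP=> FD _ /andP[GD _]; exact: pure_Delta.
  case/andP=> /HP[i <-] F0i /andP[/HP[j <-] F0j].
  pose L := [set K in facets Delta | F0 :&: G0 \subset K].
  pose e := [rel K K' : {set 'I_n} | adjacent_codim1 K K' && (K' \in L)].
  have /connectP[Hs eHs lastHs] : connect e (H i) (H j).
    apply: (linear_relations_connect uH _ relg ling) => [i' j'|i' j' _ ijj' adj].
      exact: pure_Delta.
    rewrite /= adj inE HD /=; apply: subset_trans ijj'.
    by rewrite subsetI F0i F0j.
  exists Hs; split=> //; last by apply: sub_path eHs => K K' /andP[].
  apply/allP; elim: Hs (H i) eHs {lastHs} => //= K s IHs K' /andP[/andP[_ KL] /IHs].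
  by rewrite KL.
pose m := #|facets Delta|; pose H : 'I_m -> {set 'I_n} := enum_val.
have HD i : H i \in facets Delta by exact: enum_valP.
have cardH i j : #|H i| = #|H j| by exact: pure_Delta.
have HP F : F \in facets Delta -> exists i, H i = F.
  by move=> FD; exists (enum_rank_in FD F); rewrite /H enum_rankK_in.
pose u i : 'X_{1..n} := mesym1 (~: H i).
exists m, u; split.
- have Iu p : stanley_reisner_ideal (alexander_dual Delta) p <->
      spanned (V := {mpoly k[n]}^o) [set: 'I_m] (fun i => 'X_[k, u i]) p.
    rewrite stanley_reisner_alexander_dual //.
    have -> : facets Delta = H @: [set: 'I_m].
      apply/setP=> F; apply/idP/imsetP=> [/HP[i <-]|[i _ ->]] //; by exists i.
    rewrite -spanned_imset; split=> -[a ->]; exists a;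
    by apply: eq_bigr => i _; rewrite squarefree_monomialE.
  split=> // A IA; apply/setP=> i; rewrite inE.
  have [|j jA] := @monomial_spanned k n _ A u (u i); last first.
    rewrite mesym1_le setCS => /(facets_antichain (HD i) (HD j)).
    by move=> /enum_val_inj ->.
  apply/IA/Iu.
  by apply: (spanned_gen (V := {mpoly k[n]}^o) (fun i => 'X_[k, u i])); rewrite inE.
(* Without facets there are no generators, and any degree will do. *)
- have [i _|m0] := pickP (fun i : 'I_m => true); last first.
    by exists 0 => i; have := m0 i.
  by exists (mdeg (u i)) => j; apply/eqP; rewrite !mdeg_mesym1 -(eqn_add2l #|H j|)
    cardsC (cardH j i) cardsC.
have [|r [f minf]] := minimal_generators_subfamily
    (J := ('I_m * 'I_m)%type) (g := adjacent_relation k H)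
    (N := relation_of (fun i => 'X_[k, u i])).
  apply: relations_spanned_by_adjacent => i j.
  have [_] := conn (H i) (H j) (HD i) (HD j).
  rewrite facets_pair_complex => /(_ (H i) (H j)).
  rewrite ![_ \in [set _ in _ | _]]inE !HD subsetIl subsetIr.
  case/(_ isT isT)=> Hs [sHs pHs lastHs].
  have HK : {in facets Delta, cancel (enum_rank_in (HD i)) H}.
    exact: enum_rankK_in.
  have HHs : map H (map (enum_rank_in (HD i)) Hs) = Hs.
    by rewrite -map_comp map_id_in // => K /sHs; rewrite inE => /andP[/HK].
  exists (map (enum_rank_in (HD i)) Hs); split.
  - by rewrite -path_map HHs.
  - have : all (fun K : {set 'I_n} => H i :&: H j \subset K) Hs.
      by apply/allP=> K /sHs; rewrite inE => /andP[].
    by rewrite -{1}HHs all_map.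
  - by apply: enum_val_inj; rewrite -/H -last_map HHs.
exists r, (fun i => adjacent_relation k H (f i)); split=> // j.
exact: adjacent_relation_linear.
Qed.
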